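(* Let $V$ be a vertex operator algebra, $p$ a positive integer, $\omega_p$ a primitive $p$-th root of unity, and $\nu$ an automorphism of $V$ with $\nu^p=1_V$. Let $M$ be a vector space (not assumed graded) equipped with a linear map $Y_M(\cdot,x):V\to(\mathrm{End}\,M)[[x^{1/p},x^{-1/p}]]$ satisfying the truncation condition and the $\nu$-twisted Jacobi identity. Then for all $u,v\in V$, $w\in M$ and all $l\in\frac1p\mathbb Z$ with $l\ge l(u,w)$, $$\lim_{x_0\to -x_2+x_1}\Big((x_2+x_0)^{l}\,\frac1p\sum_{r=0}^{p-1}\omega_p^{-lrp}\,Y_M(Y(\nu^ru,x_0)v,x_2)w\Big)=P_{[[x_1,x_1^{-1}]]}\Big(x_1^{l}\,Y_M(v,x_2)\,Y_M(u,x_1)w\Big).$$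
   Context: Vector spaces are over $\mathbb C$; $\mathbb N$ denotes the nonnegative integers; $x,x_0,x_1,x_2$ are commuting formal variables; $\delta(x)=\sum_{n\in\mathbb Z}x^n$. The symbol $x^{1/p}$ is a formal variable whose $p$-th power is $x$. Binomial expansion convention: a (possibly fractional) power of a binomial is expanded in nonnegative integral powers of the second variable. A vertex operator algebra $(V,Y,\mathbf 1,\omega)$ is a $\mathbb Z$-graded space $V=\coprod_n V_{(n)}$ with $V_{(n)}=0$ for $n$ sufficiently negative and $\dim V_{(n)}<\infty$, with a linear map $v\mapsto Y(v,x)=\sum_{n\in\mathbb Z}v_nx^{-n-1}\in(\mathrm{End}\,V)[[x,x^{-1}]]$ and vectors $\mathbf 1,\omega\in V$ such that: for $v,w\in V$, $v_nw=0$ for $n$ large; $Y(\mathbf 1,x)=1_V$; $Y(v,x)\mathbf 1\in V[[x]]$ with constant term $v$; writing $Y(\omega,x)=\sum_n L(n)x^{-n-2}$, $[L(m),L(n)]=(m-n)L(m+n)+c_V\frac{m^3-m}{12}\delta_{m+n,0}1_V$ for some $c_V\in\mathbb C$, $L(0)v=nv$ for $v\in V_{(n)}$, $Y(L(-1)u,x)=\frac{d}{dx}Y(u,x)$; and the Jacobi identity $x_0^{-1}\delta\big(\frac{x_1-x_2}{x_0}\big)Y(u,x_1)Y(v,x_2)-x_0^{-1}\delta\big(\frac{x_2-x_1}{-x_0}\big)Y(v,x_2)Y(u,x_1)=x_2^{-1}\delta\big(\frac{x_1-x_0}{x_2}\big)Y(Y(u,x_0)v,x_2)$. An automorphism $\nu$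 of $V$ is a linear automorphism fixing $\omega$ and $\mathbf 1$ with $\nu Y(v,x)\nu^{-1}=Y(\nu v,x)$ for $v\in V$. Write $Y_M(v,x)=\sum_{n\in\frac1p\mathbb Z}v_n^\nu x^{-n-1}$. Truncation condition: for $v\in V$, $w\in M$, $v_n^\nu w=0$ for $n\in\frac1p\mathbb Z$ sufficiently large. $\nu$-twisted Jacobi identity: for $u,v\in V$, $x_0^{-1}\delta\big(\frac{x_1-x_2}{x_0}\big)Y_M(u,x_1)Y_M(v,x_2)-x_0^{-1}\delta\big(\frac{x_2-x_1}{-x_0}\big)Y_M(v,x_2)Y_M(u,x_1)=\frac1px_2^{-1}\sum_{r=0}^{p-1}\delta\Big(\omega_p^r\big(\frac{x_1-x_0}{x_2}\big)^{1/p}\Big)Y_M(Y(\nu^ru,x_0)v,x_2)$. $P_{[[x,x^{-1}]]}$ is the projection of a formal series with complex powers of $x$ (and coefficients in any vector space, possibly of series in other variables) onto the part with integral powers of $x$. For $u\in V$, $w\in M$, $l(u,w)$ is the smallest element of $\frac1p\mathbb N$ such that twisted weak associativity $P_{[[x_0,x_0^{-1}]]}\big((x_0+x_2)^lY_M(u,x_0+x_2)Y_M(v,x_2)w\big)=(x_2+x_0)^l\frac1p\sum_{r=0}^{p-1}\omega_p^{-lrp}Y_M(Y(\nu^ru,x_0)v,x_2)w$ holds for all $v\in V$ and all $l\in\frac1p\mathbb N$ with $l\ge l(u,w)$ (such an element exists). The formal limit $\lim_{x_0\to -x_2+x_1}f$ means: replace each power $x_0^n$ in the (fully multiplied out) formal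 series $f$ by $(-x_2+x_1)^n$, expanded in nonnegative powers of $x_1$; that this is well defined is part of the assertion. *)

(* Defs.v *)
From HB Require Import structures.
From mathcomp Require Import all_boot all_order all_algebra.
From mathcomp Require Import boolp classical_sets functions cardinality fsbigop.
From mathcomp Require Import reals complex.

Set Implicit Arguments.
Unset Strict Implicit.
Unset Printing Implicit Defensive.

Import Order.TTheory GRing.Theory Num.Theory.
Local Open Scope classical_set_scope.
Local Open Scope ring_scope.

(* Formal calculus in the commuting variables x_0, x_1, x_2.  A formal series *)
(* with rational exponents and coefficients in W is an arbitrary function     *)
(* from exponent vectors to W.  An infinite sum \sum_(i \in [set: I]) is the  *)
(* finite-support sum of fsbigop, i.e. every coefficient is required to be a  *)
(* finite sum (its value is 0 if infinitely many terms are nonzero).          *)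

Notation expo := 'rV[rat]_3.
Notation fseries W := (expo -> W).

Notation X0 := (@Ordinal 3 0 isT).
Notation X1 := (@Ordinal 3 1 isT).
Notation X2 := (@Ordinal 3 2 isT).

(* exponent vector of x_i^a *)
Definition xexp (i : 'I_3) (a : rat) : expo := a *: delta_mx 0 i.

Definition monomial (W : zmodType) (d : expo) (c : W) : fseries W :=
  fun e => if e == d then c else 0.

Definition const_ser (W : zmodType) (c : W) : fseries W := monomial 0 c.

Definition fsum (W : zmodType) (I : choiceType) (f : I -> fseries W) :
    fseries W :=
  fun e => \sum_(i \in [set: I]) f i e.

Definition ser_mul (K : fieldType) (W : lmodType K) (f : fseries K^o)
    (g : fseries W) : fseries W :=
  fsum (fun d : expo => fun e => (f d : K) *: g (e - d)).

Definition xpow (K : fieldType) (i : 'I_3) (a : rat) : fseries K^o :=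
  monomial (xexp i a) (1 : K^o).
Arguments xpow K i a : clear implicits.

Definition gbinom (s : rat) (k : nat) : rat :=
  (\prod_(i < k) (s - i%:R)) / (k`!)%:R.

(* (x_i + b x_j)^s, expanded in nonnegative integral powers of x_j *)
Definition bin_pow (K : fieldType) (i : 'I_3) (b : K) (j : 'I_3) (s : rat) :
    fseries K^o :=
  fsum (fun k : nat => monomial (xexp i (s - k%:R) + xexp j k%:R)
                         (ratr (gbinom s k) * b ^+ k : K^o)).

(* x_k^{-1} delta((x_i - x_j) / (c x_k)), for c = 1 or c = -1 *)
Definition delta_ser (K : fieldType) (c : K) (i j k : 'I_3) : fseries K^o :=
  fsum (fun n : int =>
    c ^ (- n) *: ser_mul (xpow K k (- n%:~R - 1)) (bin_pow i (-1 : K) j n%:~R)).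

(* x_k^{-1} delta(z ((x_i - x_j) / x_k)^{1/p}) *)
Definition tdelta_ser (K : fieldType) (p : nat) (z : K) (i j k : 'I_3) :
    fseries K^o :=
  fsum (fun n : int =>
    z ^ n *: ser_mul (xpow K k (- (n%:~R / p%:R) - 1))
                     (bin_pow i (-1 : K) j (n%:~R / p%:R))).

(* P_{[[x_i, x_i^{-1}]]} *)
Definition int_part (W : zmodType) (i : 'I_3) (f : fseries W) : fseries W :=
  fun e => if e 0 i \is a Num.int then f e else 0.

(* The term indexed by d is the coefficient at e of the series obtained from  *)
(* the single monomial f_d x^d by replacing x_i^(d_i) with the series g d_i.  *)
Definition subst_term (K : fieldType) (W : lmodType K) (i : 'I_3)
    (g : rat -> fseries K^o) (f : fseries W) (e d : expo) : W :=
  (g (d 0 i) (e - (d - xexp i (d 0 i))) : K) *: f d.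

Definition subst (K : fieldType) (W : lmodType K) (i : 'I_3)
    (g : rat -> fseries K^o) (f : fseries W) : fseries W :=
  fun e => \sum_(d \in [set: expo]) subst_term i g f e d.

Definition subst_defined (K : fieldType) (W : lmodType K) (i : 'I_3)
    (g : rat -> fseries K^o) (f : fseries W) : Prop :=
  forall e, finite_set [set d : expo | subst_term i g f e d != 0].

(* (- x_2 + x_1)^n = (-1)^n (x_2 - x_1)^n, expanded in nonnegative powers of  *)
(* x_1; only meant for integral n.                                            *)
Definition limpow (K : fieldType) (n : rat) : fseries K^o :=
  (-1 : K) ^ Num.floor n *: bin_pow X2 (-1 : K) X1 n.

(* lim_{x_0 -> - x_2 + x_1} f *)
Definition flim_defined (K : fieldType) (W : lmodType K) (f : fseries W) :
    Prop :=
  subst_defined X0 (@limpow K) f.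

Definition flim (K : fieldType) (W : lmodType K) (f : fseries W) : fseries W :=
  subst X0 (@limpow K) f.

(* Y(g, x_i) f for a vertex operator map Y(v, x) = \sum_n v_n x^{-n-1}, with  *)
(* v_n w written Y v n w, extended to series g and f in the vectors.          *)
Definition vop (V W : zmodType) (Y : V -> rat -> W -> W) (i : 'I_3)
    (g : fseries V) (f : fseries W) : fseries W :=
  fsum (fun dn : expo * rat => fun e =>
    Y (g dn.1) dn.2 (f (e - dn.1 - xexp i (- dn.2 - 1)))).

(* modes indexed by integers, seen as rational modes *)
Definition rat_modes (V W : zmodType) (Y : V -> int -> W -> W) :
    V -> rat -> W -> W :=
  fun v n w => if n \is a Num.int then Y v (Num.floor n) w else 0.

(* Y(u, x_i) Y(v, x_j) w *)
Definition vop2 (V W : zmodType) (Y : V -> rat -> W -> W) (u : V) (i : 'I_3)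
    (v : V) (j : 'I_3) (w : W) : fseries W :=
  vop Y i (const_ser u) (vop Y j (const_ser v) (const_ser w)).

(* Y_W(Y(u, x_0) v, x_2) w *)
Definition vop_iter (V W : zmodType) (Y : V -> rat -> V -> V)
    (YW : V -> rat -> W -> W) (u v : V) (w : W) : fseries W :=
  vop YW X2 (vop Y X0 (const_ser u) (const_ser v)) (const_ser w).

Record voa (K : fieldType) (V : lmodType K) := Voa {
  voaY : V -> int -> V -> V;
  voa_vac : V;
  voa_conf : V;
  voa_gr : int -> set V;
  voaL := fun n : int => voaY voa_conf (n + 1);
  voa_linl : forall n w, linear (fun v => voaY v n w);
  voa_linr : forall v n, linear (voaY v n);
  voa_gr_sub : forall n (a : K) u v,
    voa_gr n u -> voa_gr n v -> voa_gr n (a *: u + v);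
  voa_gr_sum : forall v : V, exists! f : int -> V,
    [/\ forall n, voa_gr n (f n), finite_set [set n | f n != 0]
      & v = \sum_(n \in [set: int]) f n];
  voa_gr_low : exists N : int, forall n v, n < N -> voa_gr n v -> v = 0;
  voa_gr_fin : forall n, exists s : seq V, forall v,
    voa_gr n v <-> exists c : 'I_(size s) -> K, v = \sum_i c i *: s`_i;
  voa_trunc : forall v w, exists N : int,
    forall n, N <= n -> voaY v n w = 0;
  voa_vacuum : forall n w, voaY voa_vac n w = if n == -1 then w else 0;
  voa_create_reg : forall v n, 0 <= n -> voaY v n voa_vac = 0;
  voa_create : forall v, voaY v (-1) voa_vac = v;
  voa_virasoro : exists c : K, forall m n w,
    voaL m (voaL n w) - voaL n (voaL m w) =
      (m - n)%:~R *: voaL (m + n) w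
      + (if m + n == 0 then (c * ((m ^+ 3 - m)%:~R / 12%:R)) *: w else 0);
  voa_L0 : forall n v, voa_gr n v -> voaL 0 v = n%:~R *: v;
  (* Y(L(-1)u, x) = d/dx Y(u, x), coefficient of x^{-n-1} *)
  voa_Lm1 : forall u n w,
    voaY (voaL (-1) u) n w = (- n)%:~R *: voaY u (n - 1) w;
  voa_jacobi : forall u v w, let Y := rat_modes voaY in
    ser_mul (delta_ser (1 : K) X1 X2 X0) (vop2 Y u X1 v X2 w)
    - ser_mul (delta_ser (-1 : K) X2 X1 X0) (vop2 Y v X2 u X1 w)
    = ser_mul (delta_ser (1 : K) X1 X0 X2) (vop_iter Y Y u v w)
}.

Definition voa_aut (K : fieldType) (V : lmodType K) (A : voa V)
    (nu : {linear V -> V}) : Prop :=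
  [/\ nu (voa_conf A) = voa_conf A, nu (voa_vac A) = voa_vac A
    & exists nu' : V -> V, [/\ cancel nu nu', cancel nu' nu
      & forall v n w, nu (voaY A v n (nu' w)) = voaY A (nu v) n w]].

(* s belongs to (1/p)Z, resp. (1/p)N *)
Definition fracZ (p : nat) (s : rat) : bool := s * p%:R \is a Num.int.
Definition fracN (p : nat) (s : rat) : bool := s * p%:R \is a Num.nat.

(* YM v n w is v^nu_n w; the modes vanish for n outside (1/p)Z *)
Record twisted_module (K : fieldType) (V : lmodType K) (A : voa V) (p : nat)
    (om : K) (nu : {linear V -> V}) (M : lmodType K)
    (YM : V -> rat -> M -> M) : Prop := TwistedModule {
  tw_linl : forall n w, linear (fun v => YM v n w);
  tw_linr : forall v n, linear (YM v n);
  tw_supp : forall v n w, ~~ fracZ p n -> YM v n w = 0;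
  tw_trunc : forall v w, exists N : rat,
    forall n, fracZ p n -> N <= n -> YM v n w = 0;
  tw_jacobi : forall u v w,
    ser_mul (delta_ser (1 : K) X1 X2 X0) (vop2 YM u X1 v X2 w)
    - ser_mul (delta_ser (-1 : K) X2 X1 X0) (vop2 YM v X2 u X1 w)
    = p%:R^-1 *: \sum_(r < p)
        ser_mul (tdelta_ser p (om ^+ r) X1 X0 X2)
          (vop_iter (rat_modes (voaY A)) YM (iter r nu u) v w)
}.

(* (x_2 + x_0)^l (1/p) \sum_{0 <= r < p} om^{-lrp} Y_M(Y(nu^r u, x_0)v, x_2)w *)
Definition assoc_rhs (K : fieldType) (V : lmodType K) (A : voa V) (p : nat)
    (om : K) (nu : {linear V -> V}) (M : lmodType K) (YM : V -> rat -> M -> M)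
    (l : rat) (u v : V) (w : M) : fseries M :=
  ser_mul (bin_pow X2 (1 : K) X0 l)
    (p%:R^-1 *: \sum_(r < p)
       om ^ (- Num.floor (l * r%:R * p%:R))
         *: vop_iter (rat_modes (voaY A)) YM (iter r nu u) v w).

(* (x_0 + x_2)^l Y_M(u, x_0 + x_2) Y_M(v, x_2) w *)
Definition assoc_lhs (K : fieldType) (V : lmodType K) (M : lmodType K)
    (YM : V -> rat -> M -> M) (l : rat) (u v : V) (w : M) : fseries M :=
  ser_mul (bin_pow X0 (1 : K) X2 l)
    (subst X1 (bin_pow X0 (1 : K) X2) (vop2 YM u X1 v X2 w)).

Definition weak_assoc_from (K : fieldType) (V : lmodType K) (A : voa V)
    (p : nat) (om : K) (nu : {linear V -> V}) (M : lmodType K)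
    (YM : V -> rat -> M -> M) (u : V) (w : M) (l0 : rat) : Prop :=
  forall (v : V) (l : rat), fracN p l -> l0 <= l ->
    int_part X0 (assoc_lhs YM l u v w) = assoc_rhs A p om nu YM l u v w.

(* l0 = l(u, w) *)
Definition is_assoc_order (K : fieldType) (V : lmodType K) (A : voa V)
    (p : nat) (om : K) (nu : {linear V -> V}) (M : lmodType K)
    (YM : V -> rat -> M -> M) (u : V) (w : M) (l0 : rat) : Prop :=
  [/\ fracN p l0, weak_assoc_from A p om nu YM u w l0
    & forall l1, fracN p l1 -> weak_assoc_from A p om nu YM u w l1 -> l0 <= l1].

(* Main.v *)
Require Import Defs.
From HB Require Import structures.
From mathcomp Require Import all_boot all_order all_algebra.
From mathcomp Require Import boolp classical_sets functions cardinality fsbigop.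
From mathcomp Require Import reals complex zify ring lra.

(** The theorem reduces, one total degree at a time, to binomial inversion.

    Fix l, u, v, w and a total degree E in x_1 and x_2.  For an integer N let
    a_N and b_N be the coefficients of x_1^N x_2^(E - N) in
    x_1^l Y_M(u, x_1) Y_M(v, x_2) w and x_1^l Y_M(v, x_2) Y_M(u, x_1) w, and
    let G_A be the coefficient of x_0^A x_2^(E - A) in the right-hand side
    (x_2 + x_0)^l (1/p) \sum_r om^(-lrp) Y_M(Y(nu^r u, x_0)v, x_2) w
    of weak associativity.  The hypotheses yield three facts.

    - Weak associativity together with the Chu-Vandermonde identity gives
      G_A = \sum_(j >= 0) binom(A + j, j) a_(A + j) ([coef_assoc_uv]); the sum
      is finite because v_n w = 0 for n large.

    - The coefficient of x_0^(-1) in the twisted Jacobi identity, again with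
      Chu-Vandermonde, gives the commutator formula
      a_C - b_C = \sum_(i >= 0) binom(- C - 1, i) G_(-1 - i)
      ([coef_commutator]).

    - Only finitely many G_A are nonzero ([coef_assoc_supp]): they vanish for A
      very negative because Y(nu^r u, x_0) v has finitely many negative powers
      of x_0, and for A large by the first fact.

    The third fact says that the limit exists, and that the coefficient of
    x_1^C x_2^(E - C) in it is the finite sum
    \sum_A (-1)^(A + C) binom(A, C) G_A, for C >= 0.  Its terms with A >= 0 add
    up to a_C by the first fact and binomial inversion; its terms with A < 0
    add up to - (a_C - b_C) by the second.  Hence the coefficient is b_C
    ([limit_coef]).  For C < 0 the limit has no such term, and inserting the
    first fact into the second gives a_C - b_C = a_C, again by binomial
    inversion, that is b_C = 0 ([coef_neg_eq0]). *)

Set Implicit Arguments.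
Unset Strict Implicit.
Unset Printing Implicit Defensive.

Import Order.TTheory GRing.Theory Num.Theory.
Local Open Scope ring_scope.
Local Open Scope complex_scope.

(** * Generalized binomial coefficients *)

Lemma gbinom0 (s : rat) : gbinom s 0 = 1.
Proof. by rewrite /gbinom big_ord0 fact0 divr1. Qed.

(** Absorption: k binom(s, k) = s binom(s - 1, k - 1). *)
Lemma gbinomS (s : rat) (k : nat) :
  (k.+1)%:R * gbinom s k.+1 = s * gbinom (s - 1) k.
Proof.
rewrite /gbinom big_ord_recl factS natrM subr0.
under eq_bigr => i _ do rewrite /= /bump leq0n add1n -natr1 opprD addrCA addrC.
by field; rewrite nat1r !pnatr_eq0 -lt0n fact_gt0.
Qed.

(** The Chu-Vandermonde identity for rational upper arguments, by induction on
    k: multiply by k = i + (k - i) and absorb each summand into one of the two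
    factors. *)
Lemma gbinom_Vandermonde (a b : rat) (k : nat) :
  \sum_(i < k.+1) gbinom a i * gbinom b (k - i) = gbinom (a + b) k.
Proof.
elim: k a b => [|k IH] a b; first by rewrite big_ord1 !gbinom0 mulr1.
have k0 : (k.+1)%:R != 0 :> rat by rewrite pnatr_eq0.
apply: (mulfI k0); rewrite gbinomS mulrDl.
have -> : a + b - 1 = a - 1 + b by ring.
rewrite -{1}IH -(addrAC a b (-1)) -addrA -IH !mulr_sumr.
rewrite (eq_bigr (fun i : 'I_k.+2 =>
    i%:R * gbinom a i * gbinom b (k.+1 - i)
    + gbinom a i * ((k.+1 - i)%:R * gbinom b (k.+1 - i)))); last first.
  by move=> i _; rewrite natrB -1?ltnS //; ring.
rewrite big_split /= big_ord_recl [X in _ + X]big_ord_recr /= subnn !mul0r mulr0.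
rewrite add0r addr0; congr (_ + _); apply: eq_bigr => i _.
  by rewrite /bump leq0n add1n gbinomS subSS mulrA.
by rewrite subSn -1?ltnS // gbinomS; ring.
Qed.

Lemma gbinom_nat (n k : nat) : gbinom n%:R k = 'C(n, k)%:R.
Proof.
elim: k n => [|k IH] n; first by rewrite gbinom0 bin0.
apply: (mulfI (_ : (k.+1)%:R != 0)); first by rewrite pnatr_eq0.
rewrite gbinomS; case: n => [|n]; first by rewrite mul0r bin0n mulr0.
by rewrite -natr1 addrK IH natr1 -!natrM mul_bin_diag.
Qed.

Lemma gbinomN (s : rat) (k : nat) :
  gbinom (- s) k = (-1) ^+ k * gbinom (s + k%:R - 1) k.
Proof.
rewrite /gbinom mulrA; congr (_ / _).
rewrite -[k in (-1) ^+ k]card_ord -prodr_const -big_split /=.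
rewrite (reindex_inj rev_ord_inj) /=; apply: eq_bigr => i _.
by rewrite natrB // -natr1; ring.
Qed.

Lemma gbinom_neg (n k : nat) :
  gbinom (-1 - n%:R) k = (-1) ^+ k * 'C(n + k, k)%:R.
Proof.
rewrite -gbinom_nat -opprD gbinomN natrD; congr (_ * gbinom _ _); ring.
Qed.

Lemma coef_Xsub1_exp (A C : nat) :
  (('X - 1) ^+ A : {poly int})`_C = (-1) ^+ (A + C) * 'C(A, C)%:R.
Proof.
have sgnC k : (-1) ^+ k = ((-1) ^+ k)%:P :> {poly int} by rewrite rmorphXn rmorphN1.
rewrite addrC exprDn coef_sum.
under eq_bigr => i _ do
  rewrite sgnC coefMn coefCM coefXn -mulrnAl.
have [CA|CA] := ltnP C A.+1; last first.
  rewrite bin_small // mulr0 big1 // => i _.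
  by rewrite eqn_leq leqNgt (leq_trans (ltn_ord i) CA) mulr0.
rewrite (bigD1 (Ordinal CA)) //= eqxx mulr1 big1 ?addr0 => [|i ne].
  rewrite mulr_natr; congr (_ *+ _).
  rewrite -[in RHS](subnK (CA : (C <= A)%N)) -addnA exprD addnn -mul2n exprM.
  by rewrite sqrrN !expr1n mulr1.
by rewrite (_ : (C == i) = false) ?mulr0 // eq_sym; apply/negbTE.
Qed.

(** Orthogonality of binomial coefficients, read off the coefficient of 'X^C in
    'X^N = (('X - 1) + 1)^N. *)
Lemma sum_alt_bin (n N C : nat) : (N < n)%N ->
  \sum_(A < n) (-1) ^+ (A + C) * ('C(A, C)%:R * 'C(N, A)%:R) = (N == C)%:R :> int.
Proof.
move=> Nn; transitivity ((('X : {poly int}) ^+ N)`_C); last by rewrite coefXn eq_sym.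
rewrite -['X](subrK 1) exprD1n coef_sum.
rewrite (big_ord_widen n (fun A => ((('X - 1) ^+ A *+ 'C(N, A) : {poly int})`_C))) //.
rewrite [RHS]big_mkcond; apply: eq_bigr => A _; rewrite mulrA.
case: ifP => [_|/negbT]; first by rewrite coefMn coef_Xsub1_exp mulr_natr.
by rewrite -leqNgt => NA; rewrite (bin_small NA) mulr0.
Qed.

(** * Binomial inversion *)

Section Inversion.
Variables (K : numFieldType) (M : lmodType K).

(** The binomial coefficient binom(s, k) as a scalar of the ground field. *)
Definition gbin (s : rat) (k : nat) : K := ratr (gbinom s k).

Lemma gbin_Vandermonde (a b : rat) (k : nat) :
  \sum_(i < k.+1) gbin a i * gbin b (k - i) = gbin (a + b) k.
Proof.
rewrite /gbin -(gbinom_Vandermonde a b) raddf_sum.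
by apply: eq_bigr => i _ /=; rewrite -rmorphM.
Qed.

Lemma gbin_nat (n k : nat) : gbin n%:R k = 'C(n, k)%:R.
Proof. by rewrite /gbin gbinom_nat ratr_nat. Qed.

Lemma gbin_neg (n k : nat) : gbin (-1 - n%:R) k = (-1) ^+ k * 'C(n + k, k)%:R.
Proof. by rewrite /gbin gbinom_neg rmorphM rmorphXn rmorphN1 rmorph_nat. Qed.

Lemma gbinN (s : rat) (k : nat) : gbin (- s) k = (-1) ^+ k * gbin (s + k%:R - 1) k.
Proof.
by rewrite /gbin gbinomN [LHS]rmorphM [X in X * _]rmorphXn rmorphN1.
Qed.

Lemma binomial_inversion (n C : nat) (a : nat -> M) : (C < n)%N ->
  \sum_(A < n) ((-1) ^+ (A + C) * 'C(A, C)%:R : K)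
     *: (\sum_(N < n) ('C(N, A)%:R : K) *: a N) = a C.
Proof.
move=> Cn; under eq_bigr => A _ do rewrite scaler_sumr.
rewrite exchange_big /=.
transitivity (\sum_(N < n) ((N == C :> nat)%:R : K) *: a N).
  apply: eq_bigr => N _; under eq_bigr => A _ do rewrite scalerA.
  rewrite -scaler_suml; congr (_ *: _).
  have := congr1 (fun z : int => z%:~R : K) (sum_alt_bin C (ltn_ord N)).
  rewrite raddf_sum /= rmorph_nat => <-; apply: eq_bigr => A _.
  by rewrite -mulrA !rmorphM /= rmorphXn /= rmorphN1 !rmorph_nat.
rewrite (bigD1 (Ordinal Cn)) //= eqxx scale1r big1 ?addr0 // => N ne.
by rewrite (_ : (_ == _) = false) ?scale0r //; apply/negbTE.
Qed.

(** The same inversion, with the two binomial matrices in the other order. *)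
Lemma binomial_inversion_tr (n C : nat) (a : nat -> M) : (C < n)%N ->
  \sum_(i < n) ('C(C, i)%:R : K) *:
     (\sum_(t < n) ((-1) ^+ (i + t) * 'C(i, t)%:R : K) *: a t) = a C.
Proof.
move=> Cn; under eq_bigr => A _ do rewrite scaler_sumr.
rewrite exchange_big /=.
transitivity (\sum_(N < n) ((N == C :> nat)%:R : K) *: a N).
  apply: eq_bigr => N _; under eq_bigr => A _ do rewrite scalerA.
  rewrite -scaler_suml; congr (_ *: _).
  have := congr1 (fun z : int => z%:~R : K) (sum_alt_bin N Cn).
  rewrite raddf_sum /= rmorph_nat eq_sym => <-; apply: eq_bigr => A _.
  by rewrite mulrC -mulrA !rmorphM /= rmorphXn /= rmorphN1 !rmorph_nat.
rewrite (bigD1 (Ordinal Cn)) //= eqxx scale1r big1 ?addr0 // => N ne.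
by rewrite (_ : (_ == _) = false) ?scale0r //; apply/negbTE.
Qed.
End Inversion.

(** The combinatorial core: [a], [b] and [G] stand for the coefficients of
    x_1^l Y_M(u, x_1) Y_M(v, x_2) w, of x_1^l Y_M(v, x_2) Y_M(u, x_1) w and of the
    associativity series in one fixed total degree.  The bound [m] in [G_assoc] is arbitrary, which encodes that
    a_N = 0 for N >= n. *)
Section LimitCoefficient.
Variables (K : numFieldType) (M : lmodType K).
Variables (a b G : int -> M) (n : nat).
Local Notation gbin := (gbin K).

Hypothesis G_assoc : forall (A : int) (m : nat), n%:Z <= A + m%:Z ->
  G A = \sum_(j < m) gbin (A + j%:Z)%:~R j *: a (A + j%:Z).
Hypothesis commutator : forall C : int,
  a C - b C = \sum_(i < n) gbin (- C - 1)%:~R i *: G (Negz i).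

Lemma assoc_coef_pos (A : nat) : (A < n)%N ->
  G A = \sum_(N < n) ('C(N, A)%:R : K) *: a N.
Proof.
move=> An; rewrite (G_assoc (m := n - A)); last by lia.
pose F (N : nat) := ('C(N, A)%:R : K) *: a N; rewrite -(big_mkord xpredT F).
rewrite (big_cat_nat (n := A)) //=; last exact: ltnW.
rewrite [X in _ = X + _]big1_seq ?add0r => [|N]; last first.
  by rewrite mem_index_iota => /andP[_ NA]; rewrite /F bin_small ?scale0r.
have := big_addn 0 n A xpredT F; rewrite add0n => ->; rewrite big_mkord.
apply: eq_bigr => j _.
rewrite -PoszD -pmulrn gbin_nat addnC; congr (_%:R *: _).
by rewrite -[in RHS](bin_sub (leq_addl j A)) addnK.
Qed.

(** At A = -1 - i the terms with j > i drop out: binom(A + j, j) = 0. *)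
Lemma assoc_coef_neg (i : nat) : (i < n)%N ->
  G (Negz i) = \sum_(t < n) ((-1) ^+ (i + t) * 'C(i, t)%:R : K) *: a (Negz t).
Proof.
move=> ltin; rewrite (G_assoc (m := i.+1 + n)); last by lia.
rewrite big_split_ord /= [X in _ + X]big1 ?addr0 => [|q _]; last first.
  have -> : (Negz i + (i.+1 + q)%N%:Z)%:~R = (q : nat)%:R :> rat.
    by rewrite NegzE PoszD addKr.
  by rewrite gbin_nat bin_small ?scale0r //; lia.
rewrite (reindex_inj rev_ord_inj) /=.
pose F t := ((-1) ^+ (i + t) * 'C(i, t)%:R : K) *: a (Negz t).
rewrite (bigID (fun t : 'I_n => (t < i.+1)%N)) /=.
rewrite [X in _ = _ + X]big1 => [|t]; last first.
  by rewrite -leqNgt => it; rewrite bin_small ?mulr0 ?scale0r.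
rewrite addr0 -(big_ord_widen n F) //; apply: eq_bigr => t _.
move: (t : nat) (leq_ord t) => {}t ti.
have -> : Negz i + (i.+1 - t.+1)%N%:Z = Negz t by lia.
rewrite subSS; congr (_ *: _).
have -> : (Negz t)%:~R = -1 - t%:R :> rat.
  by rewrite NegzE rmorphN /= -pmulrn -natr1 opprD addrC.
rewrite gbin_neg subnKC // bin_sub //; congr (_ * _).
by rewrite -[in RHS](subnK ti) -addnA exprD addnn -mul2n exprM sqrrN !expr1n mulr1.
Qed.

(** The two sums range over the powers x_0^A with A >= 0 and x_0^(-1 - i); the
    first equals a_C and the second - (a_C - b_C). *)
Lemma limit_coef (C : nat) : (C < n)%N ->
  \sum_(A < n) ((-1) ^+ (A + C) * gbin (A : nat)%:R C) *: G A
  + \sum_(i < n) ((-1) ^+ (i.+1 + C) * gbin (-1 - (i : nat)%:R) C) *: G (Negz i)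
  = b C.
Proof.
move=> Cn; have -> : b C = a C - (a C - b C) by rewrite opprB addrC subrK.
rewrite commutator -(binomial_inversion (K := K) a Cn); congr (_ + _).
  by apply: eq_bigr => A _; rewrite gbin_nat assoc_coef_pos.
rewrite -sumrN; apply: eq_bigr => i _; rewrite -scaleNr; congr (_ *: _).
have -> : (- C%:Z - 1)%:~R = -1 - C%:R :> rat by rewrite rmorphB rmorphN /= addrC.
rewrite !gbin_neg mulrA -exprD -addnA addnn -mul2n exprD exprM sqrrN !expr1n mulr1.
by rewrite exprS mulN1r mulNr addnC -[in LHS](bin_sub (leq_addr i C)) addKn.
Qed.

(** The powers x_1^(-1 - c) do not occur in x_1^l Y_M(v, x_2) Y_M(u, x_1) w, in
    accordance with the limit, which has nonnegative powers of x_1 only. *)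
Lemma coef_neg_eq0 (c : nat) : (c < n)%N -> b (Negz c) = 0.
Proof.
move=> cn; apply/eqP; rewrite -oppr_eq0 -(inj_eq (addrI (a (Negz c)))) addr0.
rewrite commutator.
rewrite -[X in _ == X](binomial_inversion_tr (K := K) (fun t => a (Negz t)) cn).
apply/eqP/eq_bigr => i _; rewrite assoc_coef_neg //.
have -> : (- Negz c - 1)%:~R = c%:R :> rat by rewrite pmulrn; congr (_%:~R); lia.
by rewrite gbin_nat.
Qed.

End LimitCoefficient.

(** * Coefficients of formal series *)

Section FiniteSums.
Variables (M : zmodType) (I : choiceType).

Lemma fsbig_uniq (s : seq I) (f : I -> M) : uniq s ->
  (forall i, f i != 0 -> i \in s) ->
  \sum_(i \in [set: I]%classic) f i = \sum_(i <- s) f i.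
Proof.
move=> us fs; rewrite (fsbigE s) // => [|i _ /negP nis].
  by apply: eq_bigl => i; rewrite in_setT.
by apply/eqP/negP => /negP /fs.
Qed.

Lemma fsbig_single (i0 : I) (f : I -> M) :
  (forall i, f i != 0 -> i = i0) -> \sum_(i \in [set: I]%classic) f i = f i0.
Proof.
move=> H; rewrite (@fsbig_uniq [:: i0]) ?big_seq1 // => i /H ->.
by rewrite inE.
Qed.

Lemma fsbig_nat (h : nat -> I) (n : nat) (f : I -> M) : injective h ->
  (forall i, f i != 0 -> exists2 k, (k < n)%N & i = h k) ->
  \sum_(i \in [set: I]%classic) f i = \sum_(k < n) f (h k).
Proof.
move=> hi H; rewrite (@fsbig_uniq [seq h k | k <- iota 0 n]).
- by rewrite big_map -[in RHS](big_mkord xpredT (fun k => f (h k))) /index_iota subn0.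
- by rewrite map_inj_uniq ?iota_uniq.
by move=> i /H[k kn ->]; rewrite map_f // mem_iota.
Qed.

(** Finite sums over the integers, split at 0; [Negz i] is -1 - i. *)
Lemma fsbig_int (h : int -> I) (n : nat) (f : I -> M) : injective h ->
  (forall i, f i != 0 -> exists2 A : int, - n%:Z <= A < n%:Z & i = h A) ->
  \sum_(i \in [set: I]%classic) f i = \sum_(A < n) f (h A) + \sum_(i < n) f (h (Negz i)).
Proof.
move=> hi H.
pose s := [seq Posz k | k <- iota 0 n] ++ [seq Negz k | k <- iota 0 n].
rewrite (@fsbig_uniq (map h s)).
- rewrite big_map big_cat !big_map /=.
  rewrite -(big_mkord xpredT (fun k => f (h (Posz k)))).
  by rewrite -(big_mkord xpredT (fun k => f (h (Negz k)))) /index_iota subn0.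
- rewrite map_inj_uniq // cat_uniq !map_inj_uniq ?iota_uniq; try by move=> ? ? [].
  by rewrite andbT; apply/hasPn => _ /mapP[k _ ->]; apply/negP => /mapP[].
move=> i /H[A An ->]; apply: map_f; rewrite mem_cat; apply/orP.
case: A An => k kn; [left|right]; apply: map_f; rewrite mem_iota; lia.
Qed.

End FiniteSums.

Section Series.
Variable K : numFieldType.
Local Notation gbin := (gbin K).
Implicit Types e d : expo.

Lemma expoP e d :
  e 0 X0 = d 0 X0 -> e 0 X1 = d 0 X1 -> e 0 X2 = d 0 X2 -> e = d.
Proof.
move=> H0 H1 H2; apply/rowP => -[[|[|[|//]]] Hi].
- by rewrite (_ : Ordinal Hi = X0) //; apply: val_inj.
- by rewrite (_ : Ordinal Hi = X1) //; apply: val_inj.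
by rewrite (_ : Ordinal Hi = X2) //; apply: val_inj.
Qed.

Lemma xexpii (i : 'I_3) a : xexp i a 0 i = a.
Proof. by rewrite !mxE !eqxx mulr1. Qed.

Lemma xexpij (i j : 'I_3) a : i != j -> xexp i a 0 j = 0.
Proof. by move=> ij; rewrite !mxE eq_sym (negbTE ij) andbF mulr0. Qed.

(** Exponent of the k-th term of (x_i + b x_j)^s. *)
Definition bin_expo (i j : 'I_3) (s : rat) (k : nat) : expo :=
  xexp i (s - k%:R) + xexp j k%:R.

Lemma bin_expo_r i j s k : i != j -> bin_expo i j s k 0 j = k%:R.
Proof. by move=> ij; rewrite mxE xexpii xexpij // add0r. Qed.

Lemma bin_expo_inj i j s : i != j -> injective (bin_expo i j s).
Proof.
move=> ij k k' /(congr1 (fun e : expo => e 0 j)).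
by rewrite !bin_expo_r // => /eqP; rewrite eqr_nat => /eqP.
Qed.

Lemma bin_powE i j (b : K) s k : i != j ->
  bin_pow i b j s (bin_expo i j s k) = gbin s k * b ^+ k :> K.
Proof.
move=> ij; rewrite /bin_pow /fsum (@fsbig_single _ _ k).
  by rewrite /monomial eqxx.
move=> k'; rewrite /monomial; case: ifP => [/eqP E _|_].
  exact: (bin_expo_inj ij (esym E)).
by rewrite eqxx.
Qed.

Lemma bin_pow_supp i j (b : K) s e : i != j ->
  bin_pow i b j s e != 0 -> exists k, e = bin_expo i j s k.
Proof.
move=> ij; apply: contra_neqP => /forallNP H.
rewrite /bin_pow /fsum fsbig1 // => k _; rewrite /monomial.
by case: eqP => // /(H k).
Qed.

Lemma ser_mul_monomial (M : lmodType K) d (c : K) (g : fseries M) e :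
  ser_mul (monomial d (c : K^o)) g e = c *: g (e - d).
Proof.
rewrite /ser_mul /fsum (@fsbig_single _ _ d) /monomial ?eqxx // => d'.
by case: ifP => [/eqP|_] //; rewrite scale0r eqxx.
Qed.

Lemma ser_mul_xpow (M : lmodType K) i a (g : fseries M) e :
  ser_mul (xpow K i a) g e = g (e - xexp i a).
Proof. by rewrite ser_mul_monomial scale1r. Qed.

Lemma ser_mul_bin_pow (M : lmodType K) i j (b : K) s (g : fseries M) e n : i != j ->
  (forall k, (n <= k)%N -> g (e - bin_expo i j s k) = 0) ->
  ser_mul (bin_pow i b j s) g e =
  \sum_(k < n) (gbin s k * b ^+ k) *: g (e - bin_expo i j s k).
Proof.
move=> ij H; rewrite /ser_mul /fsum (@fsbig_nat _ _ (bin_expo i j s) n).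
- by apply: eq_bigr => k _; rewrite bin_powE.
- exact: bin_expo_inj.
move=> d nz.
have [k dk] : exists k, d = bin_expo i j s k.
  by apply: (@bin_pow_supp _ _ b) => //; apply: contraNneq nz => ->; rewrite scale0r.
exists k => //; rewrite ltnNge; apply: contraNN nz => nk.
by rewrite dk H // scaler0.
Qed.

Lemma delta_serE (c : K) i j k d : i != j -> i != k -> j != k -> d 0 k = -1 ->
  delta_ser c i j k d = bin_pow i (-1 : K) j 0 (d - xexp k (-1)).
Proof.
move=> ij ik jk dk; rewrite /delta_ser /fsum (@fsbig_single _ _ 0).
  rewrite fctE /= oppr0 expr0z scale1r ser_mul_xpow.
  by rewrite (_ : - 0%:~R - 1 = -1 :> rat) //; ring.
move=> n; rewrite fctE ser_mul_xpow => nz.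
have /(bin_pow_supp ij)[m /(congr1 (fun e : expo => e 0 k))] :
    bin_pow i (-1 : K) j n%:~R (d - xexp k (- n%:~R - 1)) != 0.
  by apply: contraNneq nz => ->; rewrite scaler0.
rewrite !(xexpii, xexpij, mxE) // dk => E.
have /eqP : (n%:~R : rat) = 0 by lra.
by rewrite intr_eq0 => /eqP.
Qed.

Lemma bin_pow0 i j (b : K) e : i != j -> bin_pow i b j 0 e != 0 -> e = 0.
Proof.
move=> ij nz; have [k ek] := bin_pow_supp ij nz.
move: nz; rewrite ek bin_powE //; case: k ek => [|k] ek.
  by move=> _; rewrite /bin_expo subr0 /xexp !scale0r addr0.
by rewrite /gbin /gbinom big_ord_recl subr0 !mul0r rmorph0 mul0r eqxx.
Qed.

(** At x_k^(-1), and against a series without x_k, only the zeroth power of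
    x_i - x_j in the delta function contributes. *)
Lemma ser_mul_delta (M : lmodType K) (c : K) i j k (g : fseries M) e :
  i != j -> i != k -> j != k ->
  (forall d, d 0 k != 0 -> g d = 0) -> e 0 k = -1 ->
  ser_mul (delta_ser c i j k) g e = g (e - xexp k (-1)).
Proof.
move=> ij ik jk gk ek; rewrite /ser_mul /fsum (@fsbig_single _ _ (xexp k (-1))).
  rewrite delta_serE ?xexpii // subrr.
  have -> : 0 = bin_expo i j 0 0 by rewrite /bin_expo subr0 /xexp !scale0r addr0.
  by rewrite bin_powE // /gbin gbinom0 rmorph1 mul1r scale1r.
move=> d nz.
have dk : d 0 k = -1.
  apply/eqP; apply: contraNT nz => dk; rewrite gk ?scaler0 //.
  by rewrite !mxE ek -opprD oppr_eq0 addrC addr_eq0.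
apply/eqP; rewrite -subr_eq0; apply/eqP; apply: (@bin_pow0 i j (-1)) => //.
by rewrite -(delta_serE c) //; apply: contraNneq nz => ->; rewrite scale0r.
Qed.

(** Exponent of x_2^(-1) (x_0^k x_1^s x_2^(-s-k)), the k-th term of
    x_2^(-1) ((x_1 - x_0) / x_2)^(s+k). *)
Definition tdelta_expo (s : rat) (k : nat) : expo :=
  xexp X0 k%:R + xexp X1 s + xexp X2 (- (s + k%:R) - 1).

(** The exponent n/p = s + k of the fractional power is determined by k; as
    z^p = 1, the root of unity z^n depends on s only. *)
Lemma tdelta_serE p (z : K) q s k : (0 < p)%N -> z ^+ p = 1 -> s * p%:R = q%:~R ->
  tdelta_ser p z X1 X0 X2 (tdelta_expo s k)
  = z ^ q * (gbin (s + k%:R) k * (-1) ^+ k) :> K.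
Proof.
move=> p0 zp sq; have p0' : p%:R != 0 :> rat by rewrite pnatr_eq0 -lt0n.
have skp : (q + (p * k)%N%:Z)%:~R / p%:R = s + k%:R :> rat.
  by rewrite intrD -sq -pmulrn natrM mulrDl mulfK // [p%:R * _]mulrC mulfK.
rewrite /tdelta_ser /fsum (@fsbig_single _ _ (q + (p * k)%N%:Z)).
  rewrite fctE /= ser_mul_xpow skp.
  have -> : tdelta_expo s k - xexp X2 (- (s + k%:R) - 1) = bin_expo X1 X0 (s + k%:R) k.
    by rewrite /tdelta_expo /bin_expo !addrK addrC.
  rewrite bin_powE //; set B := gbin _ _ * _.
  change (z ^ (q + (p * k)%N%:Z) * B = z ^ q * B); congr (_ * _).
  case: (eqVneq z 0) zp => [->|z0] zp.
    by move/eqP: zp; rewrite expr0n eqn0Ngt p0 eq_sym oner_eq0.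
  by rewrite expfzDr // -exprnP exprM zp expr1n mulr1.
move=> n; rewrite fctE ser_mul_xpow => nz.
have /(@bin_pow_supp X1 X0 _ _ _ isT)[m /(congr1 (fun e : expo => e 0 X2))] :
    bin_pow X1 (-1 : K) X0 (n%:~R / p%:R)
      (tdelta_expo s k - xexp X2 (- (n%:~R / p%:R) - 1)) != 0.
  by apply: contraNneq nz => ->; rewrite scaler0.
rewrite !(xexpii, xexpij, mxE) // => E.
have : n%:~R / p%:R = s + k%:R by lra.
by rewrite -skp => /(mulIf (invr_neq0 p0'))/intr_inj.
Qed.

Lemma ser_mul_tdelta (M : lmodType K) p (z : K) q (g : fseries M) e n :
  (0 < p)%N -> z ^+ p = 1 ->
  e 0 X1 * p%:R = q%:~R -> (forall d, d 0 X1 != 0 -> g d = 0) ->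
  (forall k, (n <= k)%N -> g (e - tdelta_expo (e 0 X1) k) = 0) ->
  ser_mul (tdelta_ser p z X1 X0 X2) g e =
  \sum_(k < n) (z ^ q * (gbin (e 0 X1 + k%:R) k * (-1) ^+ k))
     *: g (e - tdelta_expo (e 0 X1) k).
Proof.
move=> p0 zp eq g1 gn.
rewrite /ser_mul /fsum (@fsbig_nat _ _ (tdelta_expo (e 0 X1)) n).
- by apply: eq_bigr => k _; rewrite (tdelta_serE _ p0 zp eq).
- move=> k k' /(congr1 (fun e : expo => e 0 X0)).
  by rewrite !(xexpii, xexpij, mxE) // !addr0 => /eqP; rewrite eqr_nat => /eqP.
move=> d nz.
have d1 : d 0 X1 = e 0 X1.
  by apply/eqP; apply: contraNT nz => d1; rewrite g1 ?scaler0 // !mxE subr_eq0 eq_sym.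
have [k dk] : exists k, d = tdelta_expo (e 0 X1) k.
  apply: contrapT => /forallNP H; move/eqP: nz; apply.
  suff -> : tdelta_ser p z X1 X0 X2 d = 0 by rewrite scale0r.
  rewrite /tdelta_ser /fsum fsbig1 // => m _; rewrite fctE ser_mul_xpow.
  apply/eqP/negPn/negP => nz.
  have /(@bin_pow_supp X1 X0 _ _ _ isT)[k E] :
    bin_pow X1 (-1 : K) X0 (m%:~R / p%:R) (d - xexp X2 (- (m%:~R / p%:R) - 1)) != 0.
    by apply: contraNneq nz => ->; rewrite scaler0.
  apply: (H k); move/eqP: E; rewrite subr_eq => /eqP E.
  have mp : m%:~R / p%:R = e 0 X1 + k%:R.
    by rewrite -d1 E !(xexpii, xexpij, mxE) //; ring.
  rewrite E; apply: expoP; rewrite !(xexpii, xexpij, mxE) // ?mp; ring.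
exists k => //; rewrite ltnNge; apply: contraNN nz => nk.
by rewrite dk gn // scaler0.
Qed.

End Series.

(** * Vertex operator series *)

Section VertexOperators.
Variables V W : zmodType.
Implicit Types e d : expo.

Lemma vop_constl (Y : V -> rat -> W -> W) i u (f : fseries W) e :
  (forall n w, Y 0 n w = 0) -> (forall v n, Y v n 0 = 0) ->
  (forall d, d 0 i != 0 -> f d = 0) ->
  vop Y i (const_ser u) f e = Y u (- e 0 i - 1) (f (e - xexp i (e 0 i))).
Proof.
move=> Yl Yr fi; rewrite /vop /fsum (@fsbig_single _ _ (0, - e 0 i - 1)) /=.
  rewrite /const_ser /monomial eqxx subr0; congr (Y _ _ (f (_ - xexp _ _))); ring.
move=> [d n] /= nz; have d0 : d = 0.
  apply/eqP; apply: contraNT nz => /negbTE d0.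
  by rewrite /const_ser /monomial d0 Yl.
rewrite d0 subr0 in nz *; congr (_, _).
have : (e - xexp i (- n - 1)) 0 i = 0.
  by apply/eqP; apply: contraNT nz => /fi ->; rewrite Yr.
by rewrite 2!mxE xexpii => E; lra.
Qed.

Lemma vop_constr (Y : V -> rat -> W -> W) i (g : fseries V) w e :
  (forall n w, Y 0 n w = 0) -> (forall v n, Y v n 0 = 0) ->
  (forall d, d 0 i != 0 -> g d = 0) ->
  vop Y i g (const_ser w) e = Y (g (e - xexp i (e 0 i))) (- e 0 i - 1) w.
Proof.
move=> Yl Yr gi.
rewrite /vop /fsum (@fsbig_single _ _ (e - xexp i (e 0 i), - e 0 i - 1)) /=.
  rewrite (_ : _ - _ - _ = 0) /const_ser /monomial ?eqxx // subKr.
  by rewrite (_ : - (- e 0 i - 1) - 1 = e 0 i) ?subrr //; ring.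
move=> [d n] /= nz.
have E : e - d - xexp i (- n - 1) = 0.
  apply/eqP; apply: contraNT nz => /negbTE H.
  by rewrite /const_ser /monomial H Yr.
have di : d 0 i = 0.
  by apply/eqP; apply: contraNT nz => /gi ->; rewrite Yl.
have ni : n = - e 0 i - 1.
  move: (congr1 (fun e : expo => e 0 i) E); rewrite 4!mxE xexpii [in RHS]mxE di => H.
  lra.
congr (_, _) => //; rewrite {1}ni opprD !opprK addrK in E.
by rewrite -(subr0_eq E) subKr.
Qed.

Lemma vop2E (Y : V -> rat -> W -> W) u i v j w e :
  (forall n w, Y 0 n w = 0) -> (forall v n, Y v n 0 = 0) -> i != j ->
  vop2 Y u i v j w e = Y u (- e 0 i - 1) (Y v (- e 0 j - 1)
     (const_ser w (e - xexp i (e 0 i) - xexp j (e 0 j)))).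
Proof.
move=> Yl Yr ij.
have inner d : vop Y j (const_ser v) (const_ser w) d
    = Y v (- d 0 j - 1) (const_ser w (d - xexp j (d 0 j))).
  rewrite vop_constl // => {}d dj; rewrite /const_ser /monomial.
  by case: ifP => // /eqP d0; rewrite d0 mxE eqxx in dj.
rewrite /vop2 vop_constl //; first by rewrite inner 2!mxE xexpij // oppr0 addr0.
move=> d di; rewrite inner /const_ser /monomial.
case: ifP => [/eqP/(congr1 (fun e : expo => e 0 i))|_]; last by rewrite Yr.
by rewrite 2!mxE xexpij 1?eq_sym // oppr0 addr0 mxE => H; rewrite H eqxx in di.
Qed.

Lemma vop2_X1X2 (Y : V -> rat -> W -> W) u v w e :
  (forall n w, Y 0 n w = 0) -> (forall v n, Y v n 0 = 0) ->
  vop2 Y u X1 v X2 w e =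
  if e 0 X0 == 0 then Y u (- e 0 X1 - 1) (Y v (- e 0 X2 - 1) w) else 0.
Proof.
move=> Yl Yr; rewrite vop2E // /const_ser /monomial.
have -> : (e - xexp X1 (e 0 X1) - xexp X2 (e 0 X2) == 0) = (e 0 X0 == 0).
  apply/eqP/eqP => [/(congr1 (fun e : expo => e 0 X0))|H].
    by rewrite !(xexpij, mxE) //; lra.
  by apply: expoP; rewrite !(xexpii, xexpij, mxE) // ?H; ring.
by case: ifP => // _; rewrite !Yr.
Qed.

Lemma vop2_X2X1 (Y : V -> rat -> W -> W) u v w e :
  (forall n w, Y 0 n w = 0) -> (forall v n, Y v n 0 = 0) ->
  vop2 Y v X2 u X1 w e =
  if e 0 X0 == 0 then Y v (- e 0 X2 - 1) (Y u (- e 0 X1 - 1) w) else 0.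
Proof.
move=> Yl Yr; rewrite vop2E // /const_ser /monomial.
have -> : (e - xexp X2 (e 0 X2) - xexp X1 (e 0 X1) == 0) = (e 0 X0 == 0).
  apply/eqP/eqP => [/(congr1 (fun e : expo => e 0 X0))|H].
    by rewrite !(xexpij, mxE) //; lra.
  by apply: expoP; rewrite !(xexpii, xexpij, mxE) // ?H; ring.
by case: ifP => // _; rewrite !Yr.
Qed.

End VertexOperators.

Lemma vop_iterE (V W : zmodType) (Y : V -> rat -> V -> V)
    (YW : V -> rat -> W -> W) u v w (e : expo) :
  (forall n w, Y 0 n w = 0) -> (forall v n, Y v n 0 = 0) ->
  (forall n w, YW 0 n w = 0) -> (forall v n, YW v n 0 = 0) ->
  vop_iter Y YW u v w e =
  if e 0 X1 == 0 then YW (Y u (- e 0 X0 - 1) v) (- e 0 X2 - 1) w else 0.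
Proof.
move=> Yl Yr YWl YWr.
have inner d : vop Y X0 (const_ser u) (const_ser v) d
    = Y u (- d 0 X0 - 1) (const_ser v (d - xexp X0 (d 0 X0))).
  rewrite vop_constl // => {}d dj; rewrite /const_ser /monomial.
  by case: ifP => // /eqP d0; rewrite d0 mxE eqxx in dj.
rewrite /vop_iter vop_constr //.
  rewrite inner /const_ser /monomial.
  have -> : (e - xexp X2 (e 0 X2) - xexp X0 ((e - xexp X2 (e 0 X2))%R 0 X0) == 0)
      = (e 0 X1 == 0).
    apply/eqP/eqP => [/(congr1 (fun e : expo => e 0 X1))|H].
      by rewrite !(xexpij, mxE) //; lra.
    by apply: expoP; rewrite !(xexpii, xexpij, mxE) // ?H; ring.
  by rewrite 2!mxE xexpij // oppr0 addr0; case: ifP; rewrite // Yr YWl.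
move=> d d2; rewrite inner /const_ser /monomial.
case: ifP => [/eqP/(congr1 (fun e : expo => e 0 X2))|_]; last by rewrite Yr.
by rewrite 2!mxE xexpij // oppr0 addr0 mxE => H; rewrite H eqxx in d2.
Qed.

(** * Associativity and commutator formulas *)

Lemma sum_triangle (W : zmodType) (F : nat -> nat -> W) (m : nat) :
  \sum_(i < m) \sum_(k < m - i) F i k = \sum_(j < m) \sum_(i < j.+1) F i (j - i)%N.
Proof.
elim: m => [|m IH]; first by rewrite !big_ord0.
rewrite big_ord_recr [RHS]big_ord_recr [X in _ = _ + X]big_ord_recr /=.
rewrite -IH subSnn big_ord1.
rewrite subnn addrA; congr (_ + _); rewrite -big_split; apply: eq_bigr => i _ /=.
by rewrite subSn 1?ltnW // big_ord_recr.
Qed.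

Lemma linear_eq0 (K : fieldType) (V W : lmodType K) (f : V -> W) :
  linear f -> f 0 = 0.
Proof. by move=> /(_ (-1) 0 0); rewrite scaler0 addr0 scaleN1r addNr. Qed.

Section Associativity.
Variables (K : numFieldType) (V : lmodType K) (A : voa V) (p : nat) (om : K)
  (nu : {linear V -> V}) (M : lmodType K) (YM : V -> rat -> M -> M).
Hypotheses (p_gt0 : (0 < p)%N) (om_p : om ^+ p = 1)
  (tw : twisted_module A p om nu YM).
Variables (u v : V) (w : M) (l : rat).
Hypotheses (l_frac : fracZ p l)
  (assoc : int_part X0 (assoc_lhs YM l u v w) = assoc_rhs A p om nu YM l u v w).
Local Notation gbin := (gbin K).
Local Notation Y := (rat_modes (voaY A)).
Implicit Types e d : expo.

Let YM0l n x : YM 0 n x = 0.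
Proof. exact: (linear_eq0 (tw_linl tw n x)). Qed.

Let YM0r x n : YM x n 0 = 0.
Proof. exact: (linear_eq0 (tw_linr tw x n)). Qed.

Let Y0l n x : Y 0 n x = 0.
Proof. by rewrite /rat_modes; case: ifP => // _; exact: (linear_eq0 (voa_linl A _ x)). Qed.

Let Y0r x n : Y x n 0 = 0.
Proof. by rewrite /rat_modes; case: ifP => // _; exact: (linear_eq0 (voa_linr A x _)). Qed.

(** The coefficients of Y_M(u, x_0 + x_2) Y_M(v, x_2) w. *)
Lemma subst_vop2E e m : e 0 X1 = 0 ->
  (forall k, (m <= k)%N -> YM v (k%:R - e 0 X2 - 1) w = 0) ->
  subst X1 (bin_pow X0 (1 : K) X2) (vop2 YM u X1 v X2 w) e =
  \sum_(k < m) gbin (e 0 X0 + k%:R) k *: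
     YM u (- e 0 X0 - k%:R - 1) (YM v (k%:R - e 0 X2 - 1) w).
Proof.
move=> e1 vm; pose h k : expo := xexp X1 (e 0 X0 + k%:R) + xexp X2 (e 0 X2 - k%:R).
rewrite /subst (@fsbig_nat _ _ h m).
- apply: eq_bigr => k _; rewrite /subst_term vop2_X1X2 //.
  have -> : h k 0 X0 = 0 by rewrite !(xexpii, xexpij, mxE) // addr0.
  have -> : h k 0 X1 = e 0 X0 + k%:R by rewrite !(xexpii, xexpij, mxE) // addr0.
  have -> : h k 0 X2 = e 0 X2 - k%:R by rewrite !(xexpii, xexpij, mxE) // add0r.
  rewrite eqxx; have -> : e - (h k - xexp X1 (e 0 X0 + k%:R)) =
      bin_expo X0 X2 (e 0 X0 + k%:R) k.
    by apply: expoP; rewrite !(xexpii, xexpij, mxE) // ?e1; ring.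
  rewrite bin_powE // expr1n mulr1; congr (_ *: YM u _ (YM v _ w)); ring.
- move=> k k' /(congr1 (fun e : expo => e 0 X1)).
  rewrite !(xexpii, xexpij, mxE) // !addr0 => /addrI/eqP.
  by rewrite eqr_nat => /eqP.
move=> d; rewrite /subst_term vop2_X1X2 //; case: ifP => [/eqP d0|_]; last first.
  by rewrite scaler0 eqxx.
move=> nz; have [k E] : exists k, e - (d - xexp X1 (d 0 X1)) = bin_expo X0 X2 (d 0 X1) k.
  apply: (@bin_pow_supp _ _ _ (1 : K)) => //.
  by apply: contraNneq nz => ->; rewrite scale0r.
have E0 := congr1 (fun e : expo => e 0 X0) E.
have E2 := congr1 (fun e : expo => e 0 X2) E.
rewrite !(xexpii, xexpij, mxE) // d0 in E0 E2.
have dk : d = h k.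
  apply: expoP; rewrite !(xexpii, xexpij, mxE) // ?d0; lra.
exists k => //; rewrite ltnNge; apply: contraNN nz => /vm H.
rewrite (_ : - d 0 X2 - 1 = k%:R - e 0 X2 - 1) ?H ?YM0r ?scaler0 //; lra.
Qed.

(** Multiplication by (x_0 + x_2)^l combines with the substituted powers of
    x_0 + x_2 by the Chu-Vandermonde identity. *)
Lemma assoc_lhsE e m : e 0 X1 = 0 ->
  (forall k, (m <= k)%N -> YM v (k%:R - e 0 X2 - 1) w = 0) ->
  assoc_lhs YM l u v w e =
  \sum_(j < m) gbin (e 0 X0 + j%:R) j *:
     YM u (l - 1 - (e 0 X0 + j%:R)) (YM v (j%:R - e 0 X2 - 1) w).
Proof.
move=> e1 vm.
have c0 i : (e - bin_expo X0 X2 l i) 0 X0 = e 0 X0 - l + i%:R.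
  by rewrite !(xexpii, xexpij, mxE) //; ring.
have c1 i : (e - bin_expo X0 X2 l i) 0 X1 = 0.
  by rewrite !(xexpii, xexpij, mxE) // e1; ring.
have c2 i : (e - bin_expo X0 X2 l i) 0 X2 = e 0 X2 - i%:R.
  by rewrite !(xexpii, xexpij, mxE) //; ring.
have vi i k : (m - i <= k)%N -> YM v (k%:R - (e - bin_expo X0 X2 l i) 0 X2 - 1) w = 0.
  move=> mk; rewrite c2 (_ : _ - 1 = (k + i)%N%:R - e 0 X2 - 1); last by rewrite natrD; ring.
  by apply: vm; rewrite addnC -leq_subLR.
rewrite /assoc_lhs (@ser_mul_bin_pow _ _ _ _ _ _ _ _ m) // => [|i mi]; last first.
  rewrite (@subst_vop2E _ 0) ?big_ord0 // => k _; apply: vi.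
  by rewrite (eqP mi).
under eq_bigr => i _ do rewrite (subst_vop2E (c1 i) (vi i)) scaler_sumr c0 c2.
rewrite (sum_triangle (fun i k => (gbin l i * 1 ^+ i) *: (gbin (e 0 X0 - l + i%:R + k%:R) k *:
   YM u (- (e 0 X0 - l + i%:R) - k%:R - 1) (YM v (k%:R - (e 0 X2 - i%:R) - 1) w)))).
apply: eq_bigr => j _.
rewrite -(_ : l + (e 0 X0 - l + j%:R) = e 0 X0 + j%:R); last by ring.
rewrite -gbin_Vandermonde scaler_suml; apply: eq_bigr => i _.
have ij : (i <= j)%N by rewrite -ltnS.
by rewrite scalerA expr1n mulr1 natrB //; congr (_ * gbin _ _ *: YM u _ (YM v _ w)); ring.
Qed.

(** (1/p) \sum_r om^(-lrp) Y_M(Y(nu^r u, x_0)v, x_2) w. *)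
Definition twisted_iter : fseries M :=
  p%:R^-1 *: \sum_(r < p) om ^ (- Num.floor (l * r%:R * p%:R))
               *: vop_iter Y YM (iter r nu u) v w.

Lemma twisted_iterE e :
  twisted_iter e = p%:R^-1 *: \sum_(r < p) om ^ (- Num.floor (l * r%:R * p%:R))
               *: vop_iter Y YM (iter r nu u) v w e.
Proof. by rewrite /twisted_iter fctE fct_sumE. Qed.

Lemma twisted_iter_eq0 e :
  (forall r : 'I_p, vop_iter Y YM (iter r nu u) v w e = 0) -> twisted_iter e = 0.
Proof.
by move=> H; rewrite twisted_iterE big1 ?scaler0 // => r _; rewrite H scaler0.
Qed.

Lemma twisted_iter_X1 e : e 0 X1 != 0 -> twisted_iter e = 0.
Proof.
by move=> e1; apply: twisted_iter_eq0 => r; rewrite vop_iterE // (negbTE e1).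
Qed.

Lemma twisted_iter_X0 e : e 0 X0 \isn't a Num.int -> twisted_iter e = 0.
Proof.
move=> e0; apply: twisted_iter_eq0 => r; rewrite vop_iterE //; case: ifP => // _.
rewrite /rat_modes ifF ?YM0l //; apply: contraNF e0 => H.
by rewrite (_ : e 0 X0 = - (- e 0 X0 - 1) - 1) ?rpredB ?rpredN ?rpred1 //; ring.
Qed.

Lemma vop_iter_trunc : exists n : nat, forall (r : 'I_p) e,
  e 0 X0 <= -1 - n%:R -> vop_iter Y YM (iter r nu u) v w e = 0.
Proof.
have /choice[N NP] : forall r : 'I_p, exists N : nat, forall k : int,
    N%:Z <= k -> voaY A (iter r nu u) k v = 0.
  move=> r; have [N NP] := voa_trunc A (iter r nu u) v.
  by exists `|N|%N => k kN; apply: NP; lia.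
exists (\max_r N r)%N => r e e0; rewrite vop_iterE //; case: ifP => // _.
rewrite /rat_modes; case: ifP => [/intrP[k ek]|_]; last by rewrite YM0l.
rewrite ek intrKfloor NP ?YM0l //.
have Nr : (N r <= \max_r N r)%N by exact: leq_bigmax.
suff : (\max_r N r)%N%:Z <= k by apply: le_trans; rewrite lez_nat.
by rewrite -(ler_int rat) -pmulrn -ek; lra.
Qed.

(** The root of unity in the twisted delta function at x_1^(- s - 1) is the one
    in weak associativity, as s is congruent to l modulo the integers. *)
Lemma root_exp (r : nat) (c : int) (s : rat) (q : int) :
  l - s = c%:~R -> (- s - 1) * p%:R = q%:~R ->
  (om ^+ r) ^ q = om ^ (- Num.floor (l * r%:R * p%:R)).
Proof.
move=> ls sq; have om0 : om != 0.
  apply/eqP => om0; move/eqP: om_p.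
  by rewrite om0 expr0n eqn0Ngt p_gt0 eq_sym oner_eq0.
have /intrP[L lL] := l_frac.
have -> : l * r%:R * p%:R = (L * r%:Z)%:~R by rewrite intrM -lL -pmulrn; ring.
have -> : q = (c - 1) * p%:Z - L.
  apply/(@intr_inj rat); rewrite rmorphB rmorphM rmorphB /= -sq -lL -ls.
  by rewrite rmorph1 -pmulrn; ring.
rewrite intrKfloor exprnP exprz_exp.
rewrite (_ : _ * (_ - _) = p%:Z * (r%:Z * (c - 1)) - L * r%:Z); last by ring.
by rewrite expfzDr // -exprz_exp -[om ^ p]exprnP om_p exp1rz mul1r.
Qed.

(** The twisted commutator formula for u_s and v_t with s in l + Z: the
    coefficient of x_0^(-1) x_1^(- s - 1) x_2^(- t - 1) in the Jacobi identity. *)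
Lemma commutatorE (s t : rat) (c : int) n : l - s = c%:~R ->
  (forall (r : 'I_p) e, e 0 X0 <= -1 - n%:R ->
     vop_iter Y YM (iter r nu u) v w e = 0) ->
  YM u s (YM v t w) - YM v t (YM u s w) =
  \sum_(k < n) gbin s k
     *: twisted_iter (xexp X0 (-1 - k%:R) + xexp X2 (k%:R - s - t - 1)).
Proof.
move=> ls trunc; pose e : expo := xexp X0 (-1) + xexp X1 (- s - 1) + xexp X2 (- t - 1).
have e0 : e 0 X0 = -1 by rewrite !(xexpii, xexpij, mxE) // !addr0.
have e1 : e 0 X1 = - s - 1 by rewrite !(xexpii, xexpij, mxE) // !addr0 add0r.
have e2 : e 0 X2 = - t - 1 by rewrite !(xexpii, xexpij, mxE) // !add0r.
have /intrP[q sq] : (- s - 1) * p%:R \is a Num.int.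
  rewrite (_ : _ * _ = (c%:~R - 1) * p%:R - l * p%:R); last by rewrite -ls; ring.
  by rewrite rpredB // rpredM ?rpred_nat // rpredB ?rpred1 ?intr_int.
have := congr1 (fun f : fseries M => f e) (tw_jacobi tw u v w).
rewrite /= !fctE fct_sumE !ser_mul_delta //; last 2 first.
- by move=> d d0; rewrite vop2_X2X1 // (negbTE d0).
- by move=> d d0; rewrite vop2_X1X2 // (negbTE d0).
have d0 : (e - xexp X0 (-1)) 0 X0 = 0 by rewrite !(xexpii, xexpij, mxE) //; ring.
have d1 : (e - xexp X0 (-1)) 0 X1 = - s - 1 by rewrite !(xexpii, xexpij, mxE) //; ring.
have d2 : (e - xexp X0 (-1)) 0 X2 = - t - 1 by rewrite !(xexpii, xexpij, mxE) //; ring.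
rewrite vop2_X1X2 // vop2_X2X1 // d0 d1 d2 eqxx.
rewrite (_ : - (- s - 1) - 1 = s); last by ring.
rewrite (_ : - (- t - 1) - 1 = t); last by ring.
move=> ->.
have ek k : e - tdelta_expo (- s - 1) k = xexp X0 (-1 - k%:R) + xexp X2 (k%:R - s - t - 1).
  by apply: expoP; rewrite !(xexpii, xexpij, mxE) //; ring.
under [RHS]eq_bigr => k _ do rewrite twisted_iterE scalerA mulrC -scalerA scaler_sumr.
rewrite -scaler_sumr exchange_big /=; congr (_ *: _); apply: eq_bigr => r _.
rewrite (@ser_mul_tdelta _ _ p _ q _ _ n) ?e1 //.
- apply: eq_bigr => k _; rewrite ek scalerA (root_exp r ls sq) mulrC; congr (_ * _ *: _).
  rewrite -[in RHS](opprK s) gbinN mulrC.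
  by congr (_ * gbin _ _); ring.
- by rewrite exprAC om_p expr1n.
- by move=> d d1'; rewrite vop_iterE // (negbTE d1').
move=> k nk; apply: trunc; rewrite ek !(xexpii, xexpij, mxE) // addr0.
by rewrite lerD2l lerN2 ler_nat.
Qed.

(** The exponent of x_0^a x_2^(E - a). *)
Definition assoc_expo (E a : rat) : expo := xexp X0 a + xexp X2 (E - a).

Lemma assoc_rhsE (E a : rat) m :
  (forall e, e 0 X0 <= a - m%:R -> twisted_iter e = 0) ->
  assoc_rhs A p om nu YM l u v w (assoc_expo E a) =
  \sum_(k < m) gbin l k *: twisted_iter (assoc_expo (E - l) (a - k%:R)).
Proof.
move=> trunc; rewrite /assoc_rhs -/twisted_iter (@ser_mul_bin_pow _ _ _ _ _ _ _ _ m) //.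
  apply: eq_bigr => k _; rewrite expr1n mulr1; congr (_ *: twisted_iter _).
  by apply: expoP; rewrite !(xexpii, xexpij, mxE) //; ring.
move=> k mk; apply: trunc; rewrite !(xexpii, xexpij, mxE) //.
by rewrite add0r addr0 lerD2l lerN2 ler_nat.
Qed.

Lemma assoc_rhs_supp e : assoc_rhs A p om nu YM l u v w e != 0 ->
  exists2 a : int, e 0 X0 = a%:~R & e = assoc_expo (e 0 X0 + e 0 X2) a%:~R.
Proof.
move=> nz; have e0 : e 0 X0 \is a Num.int.
  apply: contraNT nz => e0; rewrite /assoc_rhs -/twisted_iter.
  rewrite (@ser_mul_bin_pow _ _ _ _ _ _ _ _ 0) ?big_ord0 // => k _.
  apply: twisted_iter_X0; apply: contraNN e0; rewrite !(xexpii, xexpij, mxE) // add0r.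
  by move=> H; rewrite -(subrK k%:R (e 0 X0)) rpredD ?rpred_nat.
have e1 : e 0 X1 = 0.
  apply/eqP; apply: contraNT nz => e1; rewrite /assoc_rhs -/twisted_iter.
  rewrite (@ser_mul_bin_pow _ _ _ _ _ _ _ _ 0) ?big_ord0 // => k _.
  by apply: twisted_iter_X1; rewrite !(xexpii, xexpij, mxE) // add0r subr0.
have /intrP[a ea] := e0; exists a => //; apply: expoP;
  by rewrite !(xexpii, xexpij, mxE) // ?e1 -?ea; ring.
Qed.

(** The coefficient of x_1^N x_2^(E - N) in x_1^l Y_M(u, x_1) Y_M(v, x_2) w. *)
Definition coef_uv (E : rat) (N : int) : M :=
  YM u (l - 1 - N%:~R) (YM v (N%:~R - E - 1) w).

(** The coefficient of x_1^N x_2^(E - N) in x_1^l Y_M(v, x_2) Y_M(u, x_1) w. *)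
Definition coef_vu (E : rat) (N : int) : M :=
  YM v (N%:~R - E - 1) (YM u (l - 1 - N%:~R) w).

(** The coefficient of x_0^a x_2^(E - a) in the associativity series. *)
Definition coef_assoc (E : rat) (a : int) : M :=
  assoc_rhs A p om nu YM l u v w (assoc_expo E a%:~R).

(** [n] bounds all truncations in total degree [E]: the v_q w with
    q >= n - E - 1 vanish, and so does every coefficient of
    Y_M(Y(nu^r u, x_0)v, x_2) w at x_0^(-1 - n) or a lower power of x_0. *)
Definition trunc_bound (E : rat) (n : nat) : Prop :=
  (forall q, n%:R - E - 1 <= q -> YM v q w = 0) /\
  (forall (r : 'I_p) e, e 0 X0 <= -1 - n%:R ->
     vop_iter Y YM (iter r nu u) v w e = 0).

Lemma trunc_bound_exists E k : exists2 n, (k < n)%N & trunc_bound E n.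
Proof.
have [N NP] := tw_trunc tw v w; have [n nP] := vop_iter_trunc.
pose m := Num.bound `|N + E + 1|.
have mN : N <= m%:R - E - 1.
  by have := le_lt_trans (ler_norm _) (archi_boundP (normr_ge0 (N + E + 1))); rewrite -/m; lra.
exists (k.+1 + n + m)%N; first by lia.
split=> [q qN|r e e0].
  have [pq|pq] := boolP (fracZ p q); last exact: (tw_supp tw).
  apply: NP => //; apply: le_trans mN (le_trans _ qN).
  by rewrite !lerD2r ler_nat leq_addl.
apply: nP; apply: le_trans e0 _; rewrite lerD2l lerN2 ler_nat; lia.
Qed.

Lemma coef_assoc_uv E n (a : int) m : trunc_bound E n -> n%:Z <= a + m%:Z ->
  coef_assoc E a = \sum_(j < m) gbin (a + j%:Z)%:~R j *: coef_uv E (a + j%:Z).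
Proof.
move=> [vn _] nm; have e0 : assoc_expo E a%:~R 0 X0 = a%:~R.
  by rewrite !(xexpii, xexpij, mxE) // addr0.
have e1 : assoc_expo E a%:~R 0 X1 = 0 by rewrite !(xexpii, xexpij, mxE) // addr0.
have e2 : assoc_expo E a%:~R 0 X2 = E - a%:~R.
  by rewrite !(xexpii, xexpij, mxE) // add0r.
rewrite /coef_assoc -assoc /int_part e0 intr_int (@assoc_lhsE _ m) // ?e0 ?e2.
  apply: eq_bigr => j _; rewrite /coef_uv intrD -[j%:~R]pmulrn.
  congr (_ *: YM u _ (YM v _ w)); ring.
move=> k mk; apply: vn; move: nm; rewrite -(ler_int rat) intrD -!pmulrn => nm.
have : m%:R <= k%:R :> rat by rewrite ler_nat.
lra.
Qed.

(** The commutator formula in terms of the associativity series: for s = l - 1 - c,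
    binom(s, k) splits as a convolution of binom(- c - 1, i) and binom(l, k - i),
    and the second factor comes from (x_2 + x_0)^l. *)
Lemma coef_commutator E n (c : int) : trunc_bound E n ->
  coef_uv E c - coef_vu E c =
  \sum_(i < n) gbin (- c - 1)%:~R i *: coef_assoc E (Negz i).
Proof.
move=> [_ trunc].
have ltrunc e : e 0 X0 <= -1 - n%:R -> twisted_iter e = 0.
  by move=> e0; apply: twisted_iter_eq0 => r; apply: trunc.
rewrite /coef_uv /coef_vu (@commutatorE _ _ (c + 1) n) //; last first.
  by rewrite intrD; ring.
have negz i : (Negz i)%:~R = - 1 - i%:R :> rat.
  by rewrite NegzE rmorphN /= -pmulrn -natr1; ring.
transitivity (\sum_(i < n) \sum_(k < n - i) (gbin (- c - 1)%:~R i * gbin l k)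
    *: twisted_iter (assoc_expo (E - l) (-1 - i%:R - k%:R))); last first.
  apply: eq_bigr => i _; rewrite /coef_assoc (@assoc_rhsE _ _ (n - i)).
    by rewrite scaler_sumr; apply: eq_bigr => k _; rewrite scalerA negz.
  by move=> e; rewrite negz natrB ?(ltnW (ltn_ord i)) // => ?; apply: ltrunc; lra.
rewrite (sum_triangle (fun i k => (gbin (- c - 1)%:~R i * gbin l k)
    *: twisted_iter (assoc_expo (E - l) (-1 - i%:R - k%:R)))).
apply: eq_bigr => j _.
rewrite (_ : l - 1 - c%:~R = (- c - 1)%:~R + l); last first.
  by rewrite rmorphB rmorphN /=; ring.
rewrite -gbin_Vandermonde scaler_suml; apply: eq_bigr => i _; congr (_ *: twisted_iter _).
have ij : (i <= j)%N by rewrite -ltnS.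
rewrite natrB //; apply: expoP; rewrite !(xexpii, xexpij, mxE) //; ring.
Qed.

Lemma coef_assoc_supp E n (a : int) : trunc_bound E n -> coef_assoc E a != 0 ->
  - n%:Z <= a < n%:Z.
Proof.
move=> tb nz; apply/andP; split.
  rewrite leNgt; apply: contraNN nz => an.
  have ltrunc e : e 0 X0 <= -1 - n%:R -> twisted_iter e = 0.
    by move=> e0; apply: twisted_iter_eq0 => r; apply: tb.2.
  rewrite /coef_assoc (@assoc_rhsE _ _ 0) ?big_ord0 // => e e0; apply: ltrunc.
  have : (a + 1 + n%:Z)%:~R <= 0 :> rat by rewrite lerz0; lia.
  by rewrite !intrD -!pmulrn; lra.
rewrite ltNge; apply: contraNN nz => an.
by rewrite (@coef_assoc_uv E n a 0) ?big_ord0 // addr0.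
Qed.

(** * The limit x_0 -> - x_2 + x_1 *)

Lemma limpowE (a : int) k :
  limpow K a%:~R (bin_expo X2 X1 a%:~R k) = (-1) ^ a * (gbin a%:~R k * (-1) ^+ k) :> K.
Proof. by rewrite /limpow intrKfloor fctE bin_powE. Qed.

Lemma limit_term e (c : nat) (a : int) : e 0 X0 = 0 -> e 0 X1 = c%:R ->
  subst_term X0 (@limpow K) (assoc_rhs A p om nu YM l u v w) e
    (assoc_expo (e 0 X1 + e 0 X2) a%:~R)
  = ((-1) ^ a * (gbin a%:~R c * (-1) ^+ c)) *: coef_assoc (e 0 X1 + e 0 X2) a.
Proof.
move=> e0 e1; rewrite /subst_term.
have -> : assoc_expo (e 0 X1 + e 0 X2) a%:~R 0 X0 = a%:~R.
  by rewrite !(xexpii, xexpij, mxE) // addr0.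
rewrite (_ : _ - _ = bin_expo X2 X1 a%:~R c) ?limpowE //.
by apply: expoP; rewrite !(xexpii, xexpij, mxE) // ?e0 ?e1; ring.
Qed.

(** Only monomials x_0^a x_2^(E - a) of the total degree E of x_1^(e_1) x_2^(e_2)
    contribute to that coefficient of the limit, and finitely many of them. *)
Lemma limit_supp e d n : trunc_bound (e 0 X1 + e 0 X2) n ->
  subst_term X0 (@limpow K) (assoc_rhs A p om nu YM l u v w) e d != 0 ->
  [/\ e 0 X0 = 0, exists c : nat, e 0 X1 = c%:R
    & exists2 a : int, - n%:Z <= a < n%:Z
      & d = assoc_expo (e 0 X1 + e 0 X2) a%:~R].
Proof.
move=> tb; rewrite /subst_term => nz.
have [a da dE] : exists2 a : int, d 0 X0 = a%:~R & d = assoc_expo (d 0 X0 + d 0 X2) a%:~R.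
  by apply: assoc_rhs_supp; apply: contraNneq nz => ->; rewrite scaler0.
have [k E] : exists k, e - (d - xexp X0 (d 0 X0)) = bin_expo X2 X1 a%:~R k.
  apply: (@bin_pow_supp _ _ _ (-1 : K)) => //; apply: contraNneq nz => H.
  by rewrite da in H *; rewrite /limpow fctE H scaler0 scale0r.
have d1 : d 0 X1 = 0 by rewrite dE !(xexpii, xexpij, mxE) // addr0.
have E0 := congr1 (fun e : expo => e 0 X0) E.
have E1 := congr1 (fun e : expo => e 0 X1) E.
have E2 := congr1 (fun e : expo => e 0 X2) E.
rewrite !(xexpii, xexpij, mxE) // d1 ?da in E0 E1 E2.
have tot : d 0 X0 + d 0 X2 = e 0 X1 + e 0 X2 by rewrite da; lra.
split; [lra|by exists k; lra|exists a; last by rewrite -tot].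
apply: (coef_assoc_supp tb); rewrite /coef_assoc -tot -dE.
by apply: contraNneq nz => ->; rewrite scaler0.
Qed.

Lemma limit_defined : flim_defined (assoc_rhs A p om nu YM l u v w).
Proof.
move=> e; have [n _ tb] := trunc_bound_exists (e 0 X1 + e 0 X2) 0.
pose s := [seq assoc_expo (e 0 X1 + e 0 X2) a%:~R
  | a <- [seq Posz k | k <- iota 0 n] ++ [seq Negz k | k <- iota 0 n]].
apply: (@sub_finite_set _ _ [set` s]%classic); last exact: finite_seq.
move=> d /= /(limit_supp tb)[_ _ [a an ->]]; apply: map_f.
rewrite mem_cat; apply/orP.
by case: a an => k kn; [left|right]; apply: map_f; rewrite mem_iota; lia.
Qed.

Lemma assoc_expo_inj E : injective (fun a : int => assoc_expo E a%:~R).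
Proof.
move=> a a' /(congr1 (fun e : expo => e 0 X0)).
by rewrite !(xexpii, xexpij, mxE) // !addr0 => /intr_inj.
Qed.

Lemma limitE : flim (assoc_rhs A p om nu YM l u v w) =
  int_part X1 (ser_mul (xpow K X1 l) (vop2 YM v X2 u X1 w)).
Proof.
apply: funext => e; rewrite /int_part ser_mul_xpow vop2_X2X1 //.
have -> : (e - xexp X1 l) 0 X0 = e 0 X0 by rewrite !(xexpii, xexpij, mxE) //; ring.
have -> : (e - xexp X1 l) 0 X1 = e 0 X1 - l by rewrite !(xexpii, xexpij, mxE) //; ring.
have -> : (e - xexp X1 l) 0 X2 = e 0 X2 by rewrite !(xexpii, xexpij, mxE) //; ring.
pose E := e 0 X1 + e 0 X2.
have zero : ~ (e 0 X0 = 0 /\ exists c : nat, e 0 X1 = c%:R) ->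
    flim (assoc_rhs A p om nu YM l u v w) e = 0.
  move=> H; have [n _ tb] := trunc_bound_exists E 0.
  rewrite /flim /subst fsbig1 // => d _; apply/eqP/negPn/negP.
  by case/(limit_supp tb) => e0 e1 _; apply: H.
have [/intrP[c ec]|e1] := boolP (e 0 X1 \is a Num.int); last first.
  by apply: zero => -[_ [c ec]]; rewrite ec rpred_nat in e1.
have [e0|e0] := eqVneq (e 0 X0) 0; last by apply: zero => -[/eqP]; rewrite (negbTE e0).
have -> : YM v (- e 0 X2 - 1) (YM u (- (e 0 X1 - l) - 1) w) = coef_vu E c.
  by rewrite /coef_vu /E ec; congr (YM v _ (YM u _ w)); ring.
case: c ec => c ec; last first.
  have [n cn tb] := trunc_bound_exists E c.
  rewrite zero; last first.
    move=> [_ [k]]; rewrite ec pmulrn => /intr_inj; lia.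
  (* e_1 = -1 - c: the limit has no negative powers of x_1 *)
  symmetry; apply: (@coef_neg_eq0 _ _ (coef_uv E) _ (coef_assoc E) n) => //.
  - by move=> a m; exact: (coef_assoc_uv tb).
  by move=> c'; exact: (coef_commutator _ tb).
have [n cn tb] := trunc_bound_exists E c.
rewrite /flim /subst (@fsbig_int _ _ (fun a : int => assoc_expo E a%:~R) n).
- rewrite -(limit_coef (a := coef_uv E) (G := coef_assoc E)
    (fun a m => @coef_assoc_uv E n a m tb) (fun c' => coef_commutator c' tb) cn).
  congr (_ + _); apply: eq_bigr => i _; rewrite (@limit_term e c _ e0 ec); congr (_ *: _).
    by rewrite -exprnP -pmulrn exprD; ring.
  rewrite NegzE -exprz_inv invrN1 -exprnP exprD rmorphN /= -pmulrn -natr1.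
  by rewrite opprD [- _ - 1]addrC; ring.
- exact: assoc_expo_inj.
by move=> d /(limit_supp tb)[_ _].
Qed.

End Associativity.

Theorem theorem3p8 (R : realType) (V : lmodType R[i]) (A : voa V) (p : nat)
    (om : R[i]) (nu : {linear V -> V}) (M : lmodType R[i])
    (YM : V -> rat -> M -> M) :
  (0 < p)%N ->
  p.-primitive_root om ->
  voa_aut A nu ->
  (forall v, iter p nu v = v) ->
  twisted_module A p om nu YM ->
  forall (u v : V) (w : M) (luw : rat), is_assoc_order A p om nu YM u w luw ->
  forall l : rat, fracZ p l -> luw <= l ->
    flim_defined (assoc_rhs A p om nu YM l u v w) /\
    flim (assoc_rhs A p om nu YM l u v w) =
      int_part X1 (ser_mul (xpow R[i] X1 l) (vop2 YM v X2 u X1 w)).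
Proof.
move=> p_gt0 /prim_expr_order om_p _ _ tw u v w luw [luwN assoc _] l lZ luwl.
have lN : fracN p l.
  rewrite /fracN natrEint (lZ : l * p%:R \is a Num.int) /=.
  apply: le_trans (_ : luw * p%:R <= _); first exact: natr_ge0.
  by rewrite ler_wpM2r ?ler0n.
have assoc_l := assoc v l lN luwl.
exact (conj (limit_defined p_gt0 tw lZ assoc_l) (limitE p_gt0 om_p tw lZ assoc_l)).
Qed.
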